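(* Let $t\in\mathbb{R}$ and $\theta\in\Theta$. (a) If $\theta\notin N_t$, then $\Gamma(\theta)\geqslant t$, i.e. $\Gamma_t(\theta)\geqslant 0$. (b) If $\theta\in N_t$, then $\Gamma(\theta)\leqslant t$, i.e. $\Gamma_t(\theta)\leqslant 0$. (c) $\Gamma(\theta)=t_c(\theta)$, and $S_t=\{\theta\in\Theta:\Gamma(\theta)=t\}=\{\theta\in\Theta:\Gamma_t(\theta)=0\}$.
   Context: $(\Theta,\mathcal{B})$ is a measurable space and $T:\Theta\to\Theta$ is bi-measurable (a measurable bijection with measurable inverse). Write $\mathbb{R}_\geqslant=[0,\infty)$. The function $h\in C^1(\mathbb{R}_\geqslant;\mathbb{R})$ is strictly concave with $h(0)=0$, $h'(x)>0$ for $x>0$, $h'(0)=1$ and $\lim_{x\to\infty}h(x)/x=0$. The function $g:\Theta\to(0,\infty)$ is bounded and measurable. For $t\in\mathbb{R}$ let $f_t(\theta,x)=e^{-t}g(\theta)h(x)$ on $\Theta\times\mathbb{R}_\geqslant$, and iterate: $f_t^0(\theta,x)=x$, $f_t^1=f_t$, $f_t^n(\theta,x)=f_t(T^{n-1}\theta,f_t^{n-1}(\theta,x))$. For each $t$ fix $M_t>0$ such that $f_t(\theta,M_t)<M_t$ for all $\theta\in\Theta$ (such $M_t$ exists). Put $\psi_{t,n}(\theta)=f_t^n(T^{-n}\theta,M_t)$ and define the maximal invariant function $$\varphi_t(\theta)=\lim_{n\to\infty}\psi_{t,n}(\theta)=\inf_n\psi_{t,n}(\theta).$$ Set $N_t=\{\theta\in\Theta:\varphi_t(\theta)=0\}$.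 One has $N_t\subseteq N_s$ for $t<s$. Define the critical parameter $t_c(\theta)=\inf\{t\in\mathbb{R}:\varphi_t(\theta)=0\}$ and $S_t=\{\theta\in\Theta:t_c(\theta)=t\}$. Define $$\Gamma(\theta)=\liminf_{n\to\infty}\frac1n\sum_{k=1}^n\log g(T^{-k}\theta),$$ and the fibre-wise lower backwards Lyapunov exponent at the baseline $$\Gamma_t(\theta)=\liminf_{n\to\infty}\frac1n\log\left|\frac{d}{dx}f_t^n(T^{-n}\theta,x)\Big|_{x=0}\right|=\Gamma(\theta)-t.$$ Values in the extended reals are allowed for $\Gamma$ and $t_c$. *)

(* Defs.v *)
From HB Require Import structures.
From mathcomp Require Import all_boot all_order all_algebra.
From mathcomp Require Import all_classical all_reals all_analysis.

Set Implicit Arguments.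
Unset Strict Implicit.
Unset Printing Implicit Defensive.

Import Order.TTheory GRing.Theory Num.Theory.
Import numFieldNormedType.Exports.

Local Open Scope classical_set_scope.
Local Open Scope ring_scope.

(* A function on [0, +oo) is represented by a total function R -> R of which
   only the values on [0, +oo) are constrained or used. *)
Section half_line.
Context {R : realType}.

Definition diff_quotient (F : R -> R) (x y : R) : R := (F y - F x) / (y - x).

(* Derivatives relative to [0, +oo): two-sided at x > 0, one-sided at 0. *)
Definition derivable_ge0 (F : R -> R) (x : R) : Prop :=
  cvg (diff_quotient F x y @[y --> within [set y | 0 <= y] x^']).

Definition derive_ge0 (F : R -> R) (x : R) : R :=
  lim (diff_quotient F x y @[y --> within [set y | 0 <= y] x^']).

Definition C1_ge0 (F : R -> R) : Prop :=
  (forall x, 0 <= x -> derivable_ge0 F x) /\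
  {within [set x | 0 <= x], continuous (derive_ge0 F)}.

Definition strictly_concave_ge0 (F : R -> R) : Prop :=
  forall x y p : R, 0 <= x -> 0 <= y -> x != y -> 0 < p < 1 ->
    p * F x + (1 - p) * F y < F (p * x + (1 - p) * y).

End half_line.

Section skew_product.
Context {R : realType} {Theta : Type}.
Variables (T Tinv : Theta -> Theta) (h : R -> R) (g : Theta -> R) (M : R -> R).

Definition fibre_map (t : R) (theta : Theta) (x : R) : R :=
  expR (- t) * g theta * h x.

Fixpoint fibre_iter (t : R) (n : nat) (theta : Theta) (x : R) : R :=
  if n is m.+1 then fibre_map t (iter m T theta) (fibre_iter t m theta x)
  else x.

Definition psi (t : R) (n : nat) (theta : Theta) : R :=
  fibre_iter t n (iter n Tinv theta) (M t).

(* Equals inf_n psi t n theta: under the standing hypotheses the sequence is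
   nonincreasing and bounded below by 0. *)
Definition phi (t : R) (theta : Theta) : R :=
  lim (psi t n theta @[n --> \oo]).

Definition N_ (t : R) : set Theta := [set theta | phi t theta = 0].

Definition t_c (theta : Theta) : \bar R :=
  ereal_inf [set t%:E | t in [set t : R | phi t theta = 0]].

Definition S_ (t : R) : set Theta := [set theta | t_c theta = t%:E].

(* The n = 0 term is 0 (0^-1 = 0) and does not affect the lower limit; the same
   holds for Gamma_. *)
Definition Gamma (theta : Theta) : \bar R :=
  limn_einf (fun n : nat =>
    (n%:R^-1 * \sum_(1 <= k < n.+1) ln (g (iter k Tinv theta)))%:E).

Definition Gamma_ (t : R) (theta : Theta) : \bar R :=
  limn_einf (fun n : nat =>
    (n%:R^-1 * ln `|derive_ge0 (fibre_iter t n (iter n Tinv theta)) 0|)%:E).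

End skew_product.

(* Main.v *)
(* Let A_n(t) = exp(-nt) * prod_(k <= n) g(T^-k theta) be the slope at 0 of the
   n-fold fibre map ending over theta. Since h(x) <= x, psi_{t,n} <= A_n(t) M_t,
   so a positive limit phi_t keeps A_n(t) away from 0 and Gamma >= t.
   Conversely, if Gamma > s > t then inf_n A_n(s) > 0; as h has slope 1 at 0 and
   increases, h(x) >= exp(t - s) min(x, e) for some e > 0, which bounds psi_{t,n}
   below by inf_n A_n(s) * min(M_t, e), hence phi_t > 0. *)

Require Import Defs.
From HB Require Import structures.
From mathcomp Require Import all_boot all_order all_algebra.
From mathcomp Require Import all_classical all_reals all_analysis.
From mathcomp Require Import ring lra.

Set Implicit Arguments.
Unset Strict Implicit.
Unset Printing Implicit Defensive.

Import Order.TTheory GRing.Theory Num.Theory.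
Import numFieldNormedType.Exports.

Local Open Scope classical_set_scope.
Local Open Scope ring_scope.

(** * Lower limits and eventual bounds *)

Section limn_einf_eventually.
Context {R : realType}.
Implicit Types (u v : (\bar R)^nat) (l x : \bar R).

Lemma limn_einf_ge u l : (\forall n \near \oo, l <= u n)%E -> (l <= limn_einf u)%E.
Proof.
move=> lu; rewrite [limn_einf u]limf_einfE.
apply: le_ereal_sup_tmp; exists (ereal_inf [set u n | n in [set n | (l <= u n)%E]]).
  by exists [set n | (l <= u n)%E].
by apply: le_ereal_inf_tmp => _ [n /= ln <-].
Qed.

Lemma limn_einf_gt u l : (l < limn_einf u)%E -> (\forall n \near \oo, l < u n)%E.
Proof.
rewrite [limn_einf u]limf_einfE => /ereal_sup_gt[_ [V Voo <-] lV].
apply: filterS Voo => n Vn; apply: (lt_le_trans lV).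
by apply: ereal_inf_lbound; exists n.
Qed.

Lemma le_limn_einf_near u v : (\forall n \near \oo, u n <= v n)%E ->
  (limn_einf u <= limn_einf v)%E.
Proof.
move=> uv; rewrite [leLHS]limf_einfE; apply: ge_ereal_sup => _ [V Voo <-].
apply: limn_einf_ge; apply: filterS2 Voo uv => n Vn; apply: le_trans.
by apply: ereal_inf_lbound; exists n.
Qed.

Lemma eq_limn_einf_near u v : (\forall n \near \oo, u n = v n) ->
  limn_einf u = limn_einf v.
Proof.
by move=> uv; apply/eqP; rewrite eq_le; apply/andP; split;
   apply: le_limn_einf_near; apply: filterS uv => n ->.
Qed.

Lemma lte_fin_between (t : R) x : (t%:E < x)%E -> exists2 s : R, t < s & (s%:E < x)%E.
Proof.
case: x => [r| |] // tx; last first.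
  by exists (t + 1); [rewrite ltrDl | exact: ltry].
by exists ((t + r) / 2); rewrite ?lte_fin; move: tx; rewrite lte_fin; lra.
Qed.

(** Only finitely many terms can drop below 1; the bound is the minimum of 1 and the terms before
    that rank. It turns an eventual bound on slopes into one valid at every time. *)
Lemma pos_seq_lbound (A : nat -> R) : (forall n, 0 < A n) ->
  (\forall n \near \oo, 1 <= A n) -> exists2 a, 0 < a & forall n, a <= A n.
Proof.
move=> A_gt0 [N _ A_ge1]; exists (\big[Order.min/1]_(i < N) A i).
  by apply/lt_bigmin.
move=> n; have [nN|Nn] := ltnP n N; first exact: (bigmin_le_cond _ (j := Ordinal nN)).
by apply: le_trans (A_ge1 _ Nn); exact: bigmin_le_id.
Qed.

End limn_einf_eventually.

(** * Derivatives and strict concavity on the half-line *)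

Section half_line.
Context {R : realType}.
Implicit Types (F : R -> R) (x y z : R).

Lemma within_ge0_dnbhs0 :
  within [set y : R | 0 <= y] (0 : R)^' = (0 : R)^'+.
Proof.
rewrite eqEsubset; split=> P nP.
  have {}nP : \forall y \near (0 : R), y != 0 -> 0 <= y -> P y := nP.
  change (\forall y \near (0 : R), 0 < y -> P y).
  by near=> y => y0; apply: (near nP y) => //; [rewrite gt_eqF | exact: ltW].
have {}nP : \forall y \near (0 : R), 0 < y -> P y := nP.
change (\forall y \near (0 : R), y != 0 -> 0 <= y -> P y).
by near=> y => yN0 y0; apply: (near nP y) => //; rewrite lt_neqAle eq_sym yN0.
Unshelve. all: by end_near. Qed.

(** Points to the right of [x >= 0] are nonnegative and differ from [x], so [x^'+] is finer than the
    filter defining [derive_ge0]. *)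
Lemma cvg_diff_quotient_right F x : 0 <= x -> derivable_ge0 F x ->
  diff_quotient F x y @[y --> x^'+] --> derive_ge0 F x.
Proof.
move=> x0 dF; apply: cvg_trans dF; apply: cvg_app => P.
move=> nP; have {}nP : \forall y \near x, y != x -> 0 <= y -> P y := nP.
change (\forall y \near x, x < y -> P y).
near=> y => xy; apply: (near nP y) => //; first by rewrite gt_eqF.
exact: le_trans (ltW xy).
Unshelve. all: by end_near. Qed.

Lemma derive_ge0_0 F (l : R) : F 0 = 0 -> F y / y @[y --> 0^'+] --> l ->
  derive_ge0 F 0 = l.
Proof.
move=> F0 Fl; rewrite /derive_ge0 within_ge0_dnbhs0; apply/cvg_lim => //.
by under eq_fun do rewrite /diff_quotient F0 !subr0.
Qed.

(** Chord slopes decrease, with denominators cleared: write [y] as the convex combination of [x] and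
    [z] with weight [(z - y) / (z - x)] on [x]. *)
Lemma strictly_concave_slope F x y z : strictly_concave_ge0 F ->
  0 <= x -> x < y -> y < z -> (y - x) * (F z - F y) < (z - y) * (F y - F x).
Proof.
move=> cF x0 xy yz; have zx : 0 < z - x by lra.
have z0 : 0 <= z by lra.
have xz : x != z by rewrite lt_eqF //; lra.
have p01 : 0 < (z - y) / (z - x) < 1.
  by rewrite divr_gt0 ?ltr_pdivrMr ?mul1r; lra.
have := cF x z _ x0 z0 xz p01.
have -> : (z - y) / (z - x) * x + (1 - (z - y) / (z - x)) * z = y.
  by field; lra.
rewrite -(ltr_pM2l zx).
have -> : (z - x) * ((z - y) / (z - x) * F x + (1 - (z - y) / (z - x)) * F z) =
  (z - y) * F x + (y - x) * F z by field; lra.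
lra.
Qed.

(** Chords issued from the origin: [F x / x] is strictly decreasing on positive [x]. *)
Lemma strictly_concave_ratio F x y : strictly_concave_ge0 F -> F 0 = 0 ->
  0 < x -> x < y -> x * F y < y * F x.
Proof.
move=> cF F0 x0 xy; have := strictly_concave_slope cF (lexx 0) x0 xy.
by rewrite F0 !subr0; lra.
Qed.

(* If F y <= F x with x < y, the chords to the right of y have nonpositive
   slope, against F' y > 0. *)
Lemma strictly_concave_increasing F x y : strictly_concave_ge0 F ->
  (forall z, 0 <= z -> derivable_ge0 F z) ->
  (forall z, 0 < z -> 0 < derive_ge0 F z) ->
  0 <= x -> x < y -> F x < F y.
Proof.
move=> cF dF dF_gt0 x0 xy; have y0 : 0 < y by exact: le_lt_trans xy.
rewrite ltNge; apply/negP => Fyx.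
have /cvgr_gt/(_ _ (dF_gt0 _ y0)) := cvg_diff_quotient_right (ltW y0) (dF _ (ltW y0)).
move=> /(filterI (nbhs_right_gt y))/filter_ex[z [/= yz]].
rewrite /diff_quotient pmulr_lgt0 ?invr_gt0 ?subr_gt0 // => Fyz.
have := strictly_concave_slope cF x0 xy yz.
have : 0 < (y - x) * (F z - F y) by apply: mulr_gt0; lra.
have : (z - y) * (F y - F x) <= 0 by apply: mulr_ge0_le0; lra.
lra.
Qed.

Section unit_slope_at_0.
Variable F : R -> R.
Hypotheses (cF : strictly_concave_ge0 F) (dF : derivable_ge0 F 0).
Hypotheses (F0 : F 0 = 0) (dF0 : derive_ge0 F 0 = 1).

Lemma cvg_ratio_0 : F y / y @[y --> 0^'+] --> (1 : R).
Proof.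
have := cvg_diff_quotient_right (lexx 0) dF; rewrite dF0.
by under eq_fun do rewrite /diff_quotient F0 !subr0.
Qed.

(** As [y] decreases to 0, the ratio [F y / y] grows towards its limit 1, so it never exceeds 1. *)
Lemma unit_slope_le_id x : 0 <= x -> F x <= x.
Proof.
rewrite le_eqVlt => /predU1P[<-|x0]; first by rewrite F0.
suff : F x / x <= 1 by rewrite ler_pdivrMr // mul1r.
rewrite -(cvg_lim _ cvg_ratio_0) //.
apply: limr_ge; first exact: cvgP cvg_ratio_0.
near=> y; have y0 : 0 < y by [].
have yx : y < x by [].
rewrite ler_pdivlMr // mulrAC ler_pdivrMr // [leLHS]mulrC [leRHS]mulrC ltW //.
exact: strictly_concave_ratio.
Unshelve. all: by end_near. Qed.

Lemma unit_slope_ge_min (q : R) : (forall x y, 0 <= x -> x < y -> F x < F y) ->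
  0 < q < 1 -> exists2 e, 0 < e & forall x, 0 < x -> q * Num.min x e <= F x.
Proof.
move=> incF /andP[q0 q1].
(* Choose [e] with [F e / e > q]. Below [e] the ratio [F x / x] is even larger; above [e]
   monotonicity gives [F x > F e > q * e]. *)
have /cvgr_gt/(_ _ q1) := cvg_ratio_0.
move=> /(filterI (nbhs_right_gt 0))/filter_ex[e [/= e0]].
rewrite ltr_pdivlMr // => qe; exists e => // x x0.
case: (ltgtP x e) => [xe|ex|->]; last exact: ltW.
  rewrite -(ler_pM2l e0); have := strictly_concave_ratio cF F0 x0 xe.
  have : x * (q * e) < x * F e by rewrite ltr_pM2l.
  by lra.
by have := incF _ _ (ltW e0) ex; lra.
Qed.

End unit_slope_at_0.

End half_line.

(** * Iterated fibre maps and the maximal invariant function *)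

Section skew_product.
Context {R : realType} {Theta : Type}.
Variables (T Tinv : Theta -> Theta) (h : R -> R) (g : Theta -> R) (M : R -> R).
Hypotheses (TinvK : cancel Tinv T) (g_gt0 : forall theta, 0 < g theta).
Hypotheses (ch : strictly_concave_ge0 h) (dh : forall x : R, 0 <= x -> derivable_ge0 h x).
Hypotheses (h0 : h 0 = 0) (dh_gt0 : forall x : R, 0 < x -> 0 < derive_ge0 h x).
Hypothesis dh0 : derive_ge0 h 0 = 1.
Hypotheses (M_gt0 : forall t, 0 < M t).
Hypothesis M_upper : forall t theta, fibre_map h g t theta (M t) < M t.

Implicit Types (t s x : R) (theta : Theta).

Local Notation f := (fibre_iter T h g).

Let h_inc x y : 0 <= x -> x < y -> h x < h y.
Proof. by apply: strictly_concave_increasing. Qed.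

Let h_gt0 x : 0 < x -> 0 < h x.
Proof. by move=> x0; rewrite -h0; exact: h_inc. Qed.

Let h_le_id x : 0 <= x -> h x <= x.
Proof. exact: unit_slope_le_id ch (dh (lexx 0)) h0 dh0 x. Qed.

Let fibre_map_gt0 t theta x : 0 < x -> 0 < fibre_map h g t theta x.
Proof. by move=> x0; rewrite !mulr_gt0 ?expR_gt0 ?h_gt0. Qed.

Lemma fibre_iter_gt0 t n theta x : 0 < x -> 0 < f t n theta x.
Proof. by move=> x0; elim: n => //= n IHn; exact: fibre_map_gt0. Qed.

Lemma fibre_iter_le t n theta x y : 0 < x -> x <= y -> f t n theta x <= f t n theta y.
Proof.
move=> x0 xy; elim: n => //= n; rewrite le_eqVlt => /predU1P[->//|fxy].
rewrite /fibre_map ler_pM2l ?mulr_gt0 ?expR_gt0 //; apply/ltW/h_inc => //.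
exact/ltW/fibre_iter_gt0.
Qed.

Lemma fibre_iterSr t n theta x :
  f t n.+1 theta x = f t n (T theta) (fibre_map h g t theta x).
Proof. by elim: n => //= n <-; rewrite -iterSr. Qed.

(** [fibre_iter] unfolds at its last step; peeling off the first step instead keeps the endpoint
    [theta] fixed, which is what inductions along the backward orbit require. *)
Lemma fibre_iterS_back t n theta x :
  f t n.+1 (iter n.+1 Tinv theta) x =
  f t n (iter n Tinv theta) (fibre_map h g t (iter n.+1 Tinv theta) x).
Proof. by rewrite fibre_iterSr iterS TinvK. Qed.

Lemma psi_gt0 t n theta : 0 < psi T Tinv h g M t n theta.
Proof. exact: fibre_iter_gt0. Qed.

(** One more step into the past sends [M t] below [M t], and the remaining [n] steps preserve
    order. *)
Lemma psi_nonincreasing t theta :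
  nonincreasing_seq (fun n => psi T Tinv h g M t n theta).
Proof.
apply/nonincreasing_seqP => n; rewrite /psi fibre_iterS_back.
by apply: fibre_iter_le; [exact: fibre_map_gt0 | exact: ltW].
Qed.

Lemma is_cvg_psi t theta : cvgn (fun n => psi T Tinv h g M t n theta).
Proof.
apply: nonincreasing_is_cvgn; first exact: psi_nonincreasing.
by exists 0 => _ [n _ <-]; exact/ltW/psi_gt0.
Qed.

Lemma phi_le_psi t n theta : phi T Tinv h g M t theta <= psi T Tinv h g M t n theta.
Proof.
exact: nonincreasing_cvgn_ge (@psi_nonincreasing t theta) (@is_cvg_psi t theta) n.
Qed.

Lemma phi_ge t theta x : (forall n, x <= psi T Tinv h g M t n theta) ->
  x <= phi T Tinv h g M t theta.
Proof. by move=> xpsi; apply: limr_ge; [exact: is_cvg_psi | exact: nearW]. Qed.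

(** * Comparison with the linearisation along the zero section *)

Definition log_sum n theta : R := \sum_(1 <= k < n.+1) ln (g (iter k Tinv theta)).

(* The slope at 0 of the n-fold fibre map at parameter t ending over theta. *)
Definition slope t n theta : R := expR (log_sum n theta - n%:R * t).

Lemma slope0 t theta : slope t 0 theta = 1.
Proof. by rewrite /slope /log_sum big_nil mul0r subr0 expR0. Qed.

Lemma slopeS t n theta :
  slope t n.+1 theta = slope t n theta * (expR (- t) * g (iter n.+1 Tinv theta)).
Proof.
rewrite /slope /log_sum big_nat_recr //= -{2}[g _]lnK ?posrE // -!expRD.
by congr expR; rewrite -natr1; ring.
Qed.

Lemma slope_gt0 t n theta : 0 < slope t n theta.
Proof. exact: expR_gt0. Qed.

(** Each fibre map lies below its tangent at 0 because [h x <= x], and the tangents compose to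
    multiplication by [slope]. *)
Lemma fibre_iter_le_slope t n theta x : 0 < x ->
  f t n (iter n Tinv theta) x <= slope t n theta * x.
Proof.
elim: n x => [|n IHn] x x0; first by rewrite slope0 mul1r.
rewrite fibre_iterS_back (le_trans (IHn _ _)) ?fibre_map_gt0 //.
rewrite slopeS -mulrA ler_pM2l ?slope_gt0 // ler_pM2l ?h_le_id ?ltW //.
by rewrite mulr_gt0 ?expR_gt0.
Qed.

(* Near 0 the map h loses at most a factor expR (t - s) against its tangent,
   which is the same as replacing the parameter t by s. *)
Lemma fibre_iter_ge_slope t s e a n theta x :
  (forall y, 0 < y -> expR (t - s) * Num.min y e <= h y) ->
  0 < e -> (forall m, a <= slope s m theta) -> 0 < x ->
  Num.min (slope s n theta * x) (a * e) <= f t n (iter n Tinv theta) x.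
Proof.
move=> hmin e0 aslope; elim: n x => [|n IHn] x x0.
  by rewrite slope0 mul1r /= ge_min lexx.
rewrite fibre_iterS_back; apply: le_trans (IHn _ _); last exact: fibre_map_gt0.
rewrite le_min [X in _ && X]ge_min lexx orbT andbT.
set c := g (iter n.+1 Tinv theta).
have c0 : 0 < c by exact: g_gt0.
(* When the inner minimum is [e], the bound [aslope] at time [n.+1] gives at least [a * e], so the
   floor does not deteriorate with [n]. *)
apply: (@le_trans _ _ (slope s n.+1 theta * Num.min x e)).
  rewrite (minr_pMr _ _ (ltW (slope_gt0 _ _ _))) le_min ge_min lexx /= ge_min.
  by rewrite ler_pM2r // aslope orbT.
rewrite slopeS -/c -mulrA ler_pM2l ?slope_gt0 // /fibre_map -/c.
have -> : - s = - t + (t - s) by ring.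
rewrite expRD -!mulrA ler_pM2l ?expR_gt0 // mulrCA ler_pM2l //; exact: hmin.
Qed.

(** Chain rule at the origin: the ratio of a composite is the ratio of the outer map at the image
    point times the ratio of the inner map. *)
Lemma cvg_fibre_iter_ratio t n theta :
  f t n (iter n Tinv theta) y / y @[y --> 0^'+] --> slope t n theta.
Proof.
have hy : h y / y @[y --> 0^'+] --> (1 : R) by exact: cvg_ratio_0 (dh (lexx 0)) h0 dh0.
elim: n => [|n IHn].
  rewrite slope0; apply: cvg_near_cst.
  by near=> y; rewrite /= divff // gt_eqF.
pose c := expR (- t) * g (iter n.+1 Tinv theta).
have c0 : 0 < c by rewrite mulr_gt0 ?expR_gt0.
have fm_ratio : fibre_map h g t (iter n.+1 Tinv theta) y / y @[y --> 0^'+] --> c.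
  rewrite -[X in _ --> X]mulr1; under eq_fun do rewrite /fibre_map -mulrA.
  exact: cvgM (cvg_cst c) hy.
have fm0 : fibre_map h g t (iter n.+1 Tinv theta) y @[y --> 0^'+] --> (0 : R).
  rewrite -[X in _ --> X](mulr0 c).
  have y0 : y @[y --> (0 : R)^'+] --> (0 : R) by exact: cvg_at_right_filter.
  apply: cvg_trans (cvgM fm_ratio y0); apply: near_eq_cvg.
  by near=> y; rewrite /= divfK // gt_eqF.
(* The induction hypothesis concerns the one-sided filter, so the image must tend to 0 through
   positive values. *)
have fm0r : fibre_map h g t (iter n.+1 Tinv theta) y @[y --> 0^'+] --> (0 : R)^'+.
  move=> P nP; have {}nP : \forall y \near (0 : R), 0 < y -> P y := nP.
  change (\forall y \near (0 : R)^'+, P (fibre_map h g t (iter n.+1 Tinv theta) y)).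
  have {nP} := fm0 _ nP; apply: filterS2 (nbhs_right_gt 0) => y y0; apply.
  exact: fibre_map_gt0.
rewrite slopeS; apply: cvg_trans (cvgM (cvg_comp _ _ fm0r IHn) fm_ratio).
apply: near_eq_cvg.
near=> y; have y0 : 0 < y by [].
rewrite /= -/(iter n.+1 _ _) -/(fibre_iter _ _ _ _ n.+1 _ _) fibre_iterS_back.
by rewrite mulrA divfK // gt_eqF // fibre_map_gt0.
Unshelve. all: by end_near. Qed.

Lemma derive_fibre_iter t n theta :
  derive_ge0 (f t n (iter n Tinv theta)) 0 = slope t n theta.
Proof.
apply: derive_ge0_0; last exact: cvg_fibre_iter_ratio.
by elim: n (iter n _ _) => //= n IHn theta'; rewrite IHn /fibre_map h0 mulr0.
Qed.

(** * The Lyapunov exponent against the critical parameter *)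

Local Notation Gam := (Gamma Tinv g).

Lemma Gamma_E t theta : Gamma_ T Tinv h g t theta = (Gam theta - t%:E)%E.
Proof.
(* Equality is only eventual: at [n = 0], where [0^-1 = 0], the terms are 0 and [- t]. *)
rewrite addeC -limn_einf_shift //; apply: eq_limn_einf_near; near=> n.
rewrite derive_fibre_iter gtr0_norm ?slope_gt0 // expRK -EFinD; congr EFin.
rewrite mulrBr mulKf 1?addrC // pnatr_eq0 -lt0n.
by near: n; exact: nbhs_infty_gt.
Unshelve. all: by end_near. Qed.

Lemma Gamma_ge t theta : ~ N_ T Tinv h g M t theta -> (t%:E <= Gam theta)%E.
Proof.
move=> /eqP phiN0.
have phi_gt0 : 0 < phi T Tinv h g M t theta.
  by rewrite lt_neqAle eq_sym phiN0 phi_ge // => n; exact/ltW/psi_gt0.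
(* From [phi <= psi <= slope * M t], the logarithm of the slope is at least [C] for all [n]; after
   division by [n] this constant disappears in the limit. *)
pose C := ln (phi T Tinv h g M t theta / M t).
have C_le n : C <= log_sum n theta - n%:R * t.
  rewrite -ler_expR lnK ?posrE ?divr_gt0 // ler_pdivrMr //.
  by apply: le_trans (phi_le_psi t n theta) _; exact: fibre_iter_le_slope.
apply/lee_addgt0Pr => e e0; rewrite -leeBlDr // -EFinB.
apply: limn_einf_ge; near=> n; rewrite lee_fin.
have n0 : 0 < n%:R :> R by rewrite ltr0n; near: n; exact: nbhs_infty_gt.
rewrite -ler_pdivrMl ?invr_gt0 // invrK -/(log_sum n theta).
(* From this rank on [C >= - n * e], so the average of the logarithms is at least [t - e]. *)
have : - C / e <= n%:R by near: n; exact: nbhs_infty_ger.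
by rewrite ler_pdivrMr // => Cne; have := C_le n; lra.
Unshelve. all: by end_near. Qed.

Lemma Gamma_le t theta : N_ T Tinv h g M t theta -> (Gam theta <= t%:E)%E.
Proof.
move=> phi0; rewrite leNgt; apply/negP => /lte_fin_between[s ts /limn_einf_gt sG].
(* The averages eventually exceed [s], so the slopes at parameter [s] are eventually at least 1. *)
have [|a a0 aslope] := @pos_seq_lbound _ (slope s ^~ theta) (fun n => slope_gt0 s n theta).
  near=> n; rewrite -expR0 ler_expR subr_ge0.
  have n0 : 0 < n%:R :> R by rewrite ltr0n; near: n; exact: nbhs_infty_gt.
  rewrite -ler_pdivlMl // ltW // -lte_fin; by near: n.
(* The gap [t < s] pays for the nonlinearity of [h] near 0. *)
have q01 : 0 < expR (t - s) < 1 by rewrite expR_gt0 expR_lt1 subr_lt0.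
have [e e0 hmin] := unit_slope_ge_min ch (dh (lexx 0)) h0 dh0 h_inc q01.
suff : a * Num.min (M t) e <= phi T Tinv h g M t theta.
  by rewrite phi0 leNgt mulr_gt0 // lt_min M_gt0.
apply: phi_ge => n; apply: le_trans (fibre_iter_ge_slope n hmin e0 aslope (M_gt0 t)).
by rewrite (minr_pMr _ _ (ltW a0)) le_min !ge_min lexx orbT andbT ler_pM2r // aslope.
Unshelve. all: by end_near. Qed.

(** By [Gamma_le], [Gam theta] is a lower bound of the parameters where [phi] vanishes; by the
    contrapositive of [Gamma_ge], every real above [Gam theta] is such a parameter. *)
Lemma Gamma_t_c theta : Gam theta = t_c T Tinv h g M theta.
Proof.
apply/eqP; rewrite eq_le; apply/andP; split.
  by apply: le_ereal_inf_tmp => _ [s /= phi0 <-]; exact: Gamma_le.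
have t_c_le s : (Gam theta < s%:E)%E -> (t_c T Tinv h g M theta <= s%:E)%E.
  move=> Gs; apply: ereal_inf_lbound; exists s => //=.
  by apply: contrapT => /Gamma_ge; rewrite leNgt Gs.
(* For the value [-oo], [t_c] lies below every real and is therefore [-oo] too. *)
case: (Gam theta) t_c_le => [r| |] t_c_le.
- by apply/lee_addgt0Pr => e e0; rewrite -EFinD t_c_le // lte_fin ltrDl.
- exact: leey.
- by rewrite leeNy_eq; apply/eqP/eq_ninfty => s; exact/t_c_le/ltNyr.
Qed.

End skew_product.

Theorem theorem1 (R : realType) (d : measure_display) (Theta : measurableType d)
    (T Tinv : Theta -> Theta) (h : R -> R) (g : Theta -> R) (M : R -> R)
    (TK : cancel T Tinv) (TinvK : cancel Tinv T)
    (mT : measurable_fun [set: Theta] T)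
    (mTinv : measurable_fun [set: Theta] Tinv)
    (h_C1 : C1_ge0 h)
    (h_concave : strictly_concave_ge0 h)
    (h0 : h 0 = 0)
    (dh_gt0 : forall x : R, 0 < x -> 0 < derive_ge0 h x)
    (dh0 : derive_ge0 h 0 = 1)
    (h_sublinear : h x / x @[x --> +oo] --> (0 : R))
    (g_gt0 : forall theta, 0 < g theta)
    (g_bounded : exists K : R, forall theta, g theta <= K)
    (mg : measurable_fun [set: Theta] g)
    (M_gt0 : forall t, 0 < M t)
    (M_upper : forall t theta, fibre_map h g t theta (M t) < M t)
    (t : R) (theta : Theta) :
  (* (a) *)
  (~ N_ T Tinv h g M t theta ->
     (t%:E <= Gamma Tinv g theta)%E /\
     (0 <= Gamma_ T Tinv h g t theta)%E) /\
  (* (b) *)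
  (N_ T Tinv h g M t theta ->
     (Gamma Tinv g theta <= t%:E)%E /\
     (Gamma_ T Tinv h g t theta <= 0)%E) /\
  (* (c) *)
  (Gamma Tinv g theta = t_c T Tinv h g M theta /\
   S_ T Tinv h g M t = [set theta' | Gamma Tinv g theta' = t%:E] /\
   S_ T Tinv h g M t = [set theta' | Gamma_ T Tinv h g t theta' = 0%E]).
Proof.
have [dh _] := h_C1.
have Gge := Gamma_ge TinvK g_gt0 h_concave dh h0 dh_gt0 dh0 M_gt0 M_upper.
have Gle := Gamma_le TinvK g_gt0 h_concave dh h0 dh_gt0 dh0 M_gt0 M_upper.
have GE := Gamma_E TinvK g_gt0 h_concave dh h0 dh_gt0 dh0.
have Gt_c := Gamma_t_c TinvK g_gt0 h_concave dh h0 dh_gt0 dh0 M_gt0 M_upper.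
have St : S_ T Tinv h g M t = [set theta' | Gamma Tinv g theta' = t%:E].
  by apply/funext => theta'; rewrite /S_ /= Gt_c.
split; [|split; [|split; [|split]]] => //.
- by move=> /Gge tG; rewrite GE sube_ge0.
- by move=> /Gle Gt; rewrite GE sube_le0.
- rewrite St; apply/seteqP; split=> theta' /=; rewrite GE.
    by move=> ->; rewrite subee.
  (* Since [t%:E] is finite, subtracting and adding it back is the identity on all extended
     reals. *)
  by move=> GE0; rewrite -[LHS](@subeK _ _ t%:E) // GE0 add0e.
Qed.
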